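(* Let $\mathbf{a}^1,\mathbf{a}^2\in\mathbb{R}^d\setminus\{\mathbf{0}\}$ and let $Q\subset\mathbb{R}^d$ be a convex compact set satisfying the following condition: (A) there is a positive integer $N_0$ such that for any path $q=(\mathbf{q}_1,\mathbf{q}_2,\dots,\mathbf{q}_n)\subset Q$ there exist points $\mathbf{q}_{n+1},\mathbf{q}_{n+2},\dots,\mathbf{q}_{n+s}\in Q$ such that $(\mathbf{q}_1,\mathbf{q}_2,\dots,\mathbf{q}_{n+s})$ is a closed path and $s\le N_0$ ($N_0$ does not depend on $q$). Let $f\in C(Q)$. Then a function $g_0\in\mathcal{R}(\mathbf{a}^1,\mathbf{a}^2)$ is a best approximation to $f$ from $\mathcal{R}(\mathbf{a}^1,\mathbf{a}^2)$, that is, $$\max_{\mathbf{x}\in Q}|f(\mathbf{x})-g_0(\mathbf{x})|=\inf_{g\in\mathcal{R}(\mathbf{a}^1,\mathbf{a}^2)}\max_{\mathbf{x}\in Q}|f(\mathbf{x})-g(\mathbf{x})|,$$ if and only if there exists a closed or infinite path $l=(\mathbf{p}_1,\mathbf{p}_2,\dots)$ in $Q$ which is extremal for the function $f_1=f-g_0$.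
   Context: $\mathcal{R}(\mathbf{a}^1,\mathbf{a}^2)=\{g_1(\mathbf{a}^1\cdot\mathbf{x})+g_2(\mathbf{a}^2\cdot\mathbf{x}):g_i\in C(\mathbb{R}),\ i=1,2\}$, considered as functions on $Q$; $\cdot$ is the standard inner product; $C(Q)$ is the space of real continuous functions on $Q$ with the uniform norm $\|\cdot\|$. A path (with respect to the directions $\mathbf{a}^1,\mathbf{a}^2$) in $Q$ is a finite or infinite ordered sequence $(\mathbf{p}_1,\mathbf{p}_2,\dots)$ of points of $Q$ with $\mathbf{p}_i\neq\mathbf{p}_{i+1}$ for all $i$ and either $\mathbf{a}^1\cdot\mathbf{p}_1=\mathbf{a}^1\cdot\mathbf{p}_2,\ \mathbf{a}^2\cdot\mathbf{p}_2=\mathbf{a}^2\cdot\mathbf{p}_3,\ \mathbf{a}^1\cdot\mathbf{p}_3=\mathbf{a}^1\cdot\mathbf{p}_4,\dots$ or $\mathbf{a}^2\cdot\mathbf{p}_1=\mathbf{a}^2\cdot\mathbf{p}_2,\ \mathbf{a}^1\cdot\mathbf{p}_2=\mathbf{a}^1\cdot\mathbf{p}_3,\ \mathbf{a}^2\cdot\mathbf{p}_3=\mathbf{a}^2\cdot\mathbf{p}_4,\dots$. A single point is a path of length one. A finite path $(\mathbf{p}_1,\dots,\mathbf{p}_{2n})$ is closed if $(\mathbf{p}_1,\dots,\mathbf{p}_{2n},\mathbf{p}_1)$ is a path. A finite or infinite path $(\mathbf{p}_1,\mathbf{p}_2,\dots)$ is extremal for $u\in C(Q)$ if either $u(\mathbf{p}_i)=(-1)^i\|u\|$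 for all $i$, or $u(\mathbf{p}_i)=(-1)^{i+1}\|u\|$ for all $i$. *)

(* Defs.v *)
From HB Require Import structures.
From mathcomp Require Import all_boot all_order all_algebra.
From mathcomp Require Import all_classical all_reals all_analysis.
Import numFieldNormedType.Exports.

Set Implicit Arguments.
Unset Strict Implicit.
Unset Printing Implicit Defensive.

Import Order.TTheory GRing.Theory Num.Theory.
Local Open Scope classical_set_scope.
Local Open Scope ring_scope.

Section RidgeSums.
Context {R : realType} {d : nat}.
Local Notation V := 'rV[R]_d.
Implicit Types (a x y : V) (Q : set V) (u f g : V -> R).

Definition dot a x : R := \sum_(j < d) a 0 j * x 0 j.

(* On a nonempty compact Q with u continuous, this supremum is a maximum. *)
Definition uniform_norm Q u : R := sup [set `|u x| | x in Q].

(* Functions on Q are functions on R^d whose values off Q are irrelevant. *)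
Definition ridge_sums Q a1 a2 : set (V -> R) :=
  [set g | exists g1 g2 : R -> R, [/\ continuous g1, continuous g2 &
     forall x, Q x -> g x = g1 (dot a1 x) + g2 (dot a2 x)]].

Definition best_approximation Q a1 a2 f g0 : Prop :=
  ridge_sums Q a1 a2 g0 /\
  uniform_norm Q (f \- g0) =
    inf [set uniform_norm Q (f \- g) | g in ridge_sums Q a1 a2].

(* Points are indexed from 0; the boolean b tells whether the first link uses
   a2 (b = true) or a1 (b = false), and later links alternate. *)
Definition link a1 a2 (b : bool) (i : nat) x y : Prop :=
  let a := if b (+) odd i then a2 else a1 in x <> y /\ dot a x = dot a y.

Definition finite_path Q a1 a2 (s : seq V) : Prop :=
  [/\ s <> [::], (forall x, x \in s -> Q x) &
    exists b, forall i, (i.+1 < size s)%N ->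
      link a1 a2 b i (nth 0 s i) (nth 0 s i.+1)].

Definition infinite_path Q a1 a2 (p : nat -> V) : Prop :=
  (forall i, Q (p i)) /\ exists b, forall i, link a1 a2 b i (p i) (p i.+1).

Definition closed_path Q a1 a2 (s : seq V) : Prop :=
  [/\ finite_path Q a1 a2 s, ~~ odd (size s) &
    finite_path Q a1 a2 (rcons s (head 0 s))].

Definition extremal_finite Q u (s : seq V) : Prop :=
  (forall i, (i < size s)%N -> u (nth 0 s i) = (-1) ^+ i.+1 * uniform_norm Q u)
  \/ (forall i, (i < size s)%N -> u (nth 0 s i) = (-1) ^+ i * uniform_norm Q u).

Definition extremal_infinite Q u (p : nat -> V) : Prop :=
  (forall i, u (p i) = (-1) ^+ i.+1 * uniform_norm Q u)
  \/ (forall i, u (p i) = (-1) ^+ i * uniform_norm Q u).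

(* The appended sequence r may be empty when q is already closed;
   requiring it to be nonempty gives the same condition up to the value of N0:
   apply the condition to the path (q_1, ..., q_2n, q_1). *)
Definition uniformly_closable Q a1 a2 : Prop :=
  exists N0 : nat, (0 < N0)%N /\
    forall q, finite_path Q a1 a2 q ->
      exists r : seq V, (size r <= N0)%N /\ closed_path Q a1 a2 (q ++ r).

End RidgeSums.

(* Main.v *)
Require Import Defs.
From HB Require Import structures.
From mathcomp Require Import all_boot all_order all_algebra.
From mathcomp Require Import all_classical all_reals all_analysis.
From mathcomp Require Import lra.

Set Implicit Arguments.
Unset Strict Implicit.
Unset Printing Implicit Defensive.

Import numFieldNormedType.Exports.
Import Order.TTheory GRing.Theory Num.Theory.
Local Open Scope classical_set_scope.
Local Open Scope ring_scope.

(* Sufficiency: along an extremal path the alternating sums of f - g0 grow like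
   n * norm (f - g0), while those of a ridge sum stay bounded, so no ridge sum
   can improve on g0; a closed path is run through periodically.

   Necessity: let u = f - g0 and E = norm u > 0, and regard each point x with
   u x = E as an arrow from the value a1.x to the value a2.x, and each x with
   u x = - E as an arrow from a2.x to a1.x.  Extremal paths are directed paths.
   If none is infinite, compactness forbids arbitrarily long pseudo-paths with
   arbitrarily small jumps, hence there is a bounded Lipschitz potential
   dropping by at least 1 along every arrow.  Its restrictions to the two kinds
   of vertices form a ridge sum that is >= 1 where u = E and <= -1 where
   u = - E, and a small multiple of it improves g0.  When E = 0 every
   closed path is extremal, and (A) provides one. *)

(** * Infinite directed paths and compactness *)

(** The i-th point has colour [b (+) odd i]. A point x of colour c is an arrow from [a c x] to
    [a (~~ c) x], so the equation makes each arrow end where the next begins. *)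
Definition alternating {R : realType} {T : Type} (K : bool -> set T)
    (a : bool -> T -> R) (b : bool) (p : nat -> T) : Prop :=
  forall i, K (b (+) odd i) (p i) /\
    a (~~ (b (+) odd i)) (p i) = a (~~ (b (+) odd i)) (p i.+1).

(* Were there pseudo-paths of every length n with jumps at most 1/(n+1), a
   cluster point of them in the product topology would have no jump at all. *)
Lemma pseudopath_jump (R : realType) (T : topologicalType)
    (K : bool -> set T) (a : bool -> T -> R) (b : bool) :
  (forall c, compact (K c)) -> (forall c, continuous (a c)) ->
  (forall p, ~ alternating K a b p) ->
  exists n : nat, forall p : nat -> T,
    (forall i, K (b (+) odd i) (p i)) ->
    exists2 i : nat, (i < n)%N & n.+1%:R^-1 <
      `|a (~~ (b (+) odd i)) (p i) - a (~~ (b (+) odd i)) (p i.+1)|.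
Proof.
move=> cK ca noalt; apply/not_existsP => jumpy.
have {jumpy}/choice[P PK] : forall n, exists p : nat -> T,
    (forall i, K (b (+) odd i) (p i)) /\ forall i, (i < n)%N ->
    `|a (~~ (b (+) odd i)) (p i) - a (~~ (b (+) odd i)) (p i.+1)| <= n.+1%:R^-1.
  move=> n; have /existsNP[p /not_implyP[pK pn]] := jumpy n.
  exists p; split=> // i ltin; rewrite leNgt; apply/negP => lt_jump.
  by apply: pn; exists i.
pose F := (P : nat -> prod_topology (fun=> T)) @ \oo.
have [p [/= pK pF]] := @tychonoff nat (fun=> T) (fun i => K (b (+) odd i))
  (fun i => cK _) F _ (filterE _ (fun n => (PK n).1)).
apply: (noalt p) => i; split; first exact: pK.
set c := ~~ _; apply/eqP; rewrite -subr_eq0 -normr_le0.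
pose D (q : prod_topology (fun _ : nat => T)) := `|a c (q i) - a c (q i.+1)|.
have cD : continuous D.
  have cp j : continuous (fun q : prod_topology (fun _ : nat => T) => a c (q j)).
    move=> q.
    apply: (@continuous_comp _ _ _
      (fun q : prod_topology (fun _ : nat => T) => q j) (a c)).
      exact: (@proj_continuous nat (fun=> T) j).
    exact: ca.
  by move=> q; exact: (cvg_norm (cvgB (cp i q) (cp i.+1 q))).
have small m : D p <= m.+1%:R^-1.
  pose B := [set x : R | x <= m.+1%:R^-1].
  have clB : closed (D @^-1` B).
    by move/continuous_closedP : cD; apply; exact: closed_le.
  apply: clB; move: pF; rewrite clusterE; apply.
  (* From this index on, the jump at i is controlled by [PK] with tolerance at most 1/(m+1); the
     closed condition passes to the cluster point. *)
  exists (maxn m i.+1) => // n /=; rewrite geq_max => /andP[lemn ltin].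
  apply: le_trans ((PK n).2 _ ltin) _.
  by rewrite lef_pV2 ?posrE// ler_nat.
rewrite leNgt; apply/negP => Dp; have [m _ mlt] := near_infty_natSinv_lt (PosNum Dp).
by have := mlt m (leqnn m); rewrite /= ltNge small.
Qed.

(** * Penalised gains of finite arrow sequences *)

(* A sequence of arrows started from the value v earns 1 per arrow and pays lam
   times the length of each jump; arrows of colour b lead from a b to a (~~ b). *)
Fixpoint gain {R : realType} {T : Type} (lam : R) (a : bool -> T -> R)
    (b : bool) (v : R) (s : seq T) : R :=
  if s is x :: s' then
    1 - lam * `|v - a b x| + gain lam a (~~ b) (a (~~ b) x) s'
  else 0.

(** Only the colours are prescribed: arrows need not meet, since [gain] charges for the jumps. *)
Definition alternating_seq {T : Type} (K : bool -> set T) (b : bool) : set (seq T) :=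
  [set s | forall x0 i, (i < size s)%N -> K (b (+) odd i) (nth x0 s i)].

Section Gain.
Context {R : realType} {T : Type}.
Variables (lam : R) (a : bool -> T -> R).
Hypothesis lam_ge0 : 0 <= lam.

Lemma gain_le_size b v s : gain lam a b v s <= (size s)%:R.
Proof.
elim: s b v => [|x s IH] b v //=.
have := IH (~~ b) (a (~~ b) x); have := mulr_ge0 lam_ge0 (normr_ge0 (v - a b x)).
by rewrite -natr1; lra.
Qed.

(** No arrow earns more than 1 and no jump has negative cost, so a single long jump lowers the bound
    for the whole sequence. *)
Lemma gain_jump x0 e b v s i : (i.+1 < size s)%N ->
  e <= `|a (~~ (b (+) odd i)) (nth x0 s i) - a (~~ (b (+) odd i)) (nth x0 s i.+1)| ->
  gain lam a b v s <= (size s)%:R - lam * e.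
Proof.
elim: i s b v => [|i IH] [|x s] //= b v.
  case: s => [|y s] //= _; rewrite addbF => le_e.
  have := ler_wpM2l lam_ge0 le_e.
  have := mulr_ge0 lam_ge0 (normr_ge0 (v - a b x)).
  have := gain_le_size (~~ ~~ b) (a (~~ ~~ b) y) s.
  by rewrite -!natr1; lra.
rewrite ltnS addbN -addNb => lti le_e.
have := IH _ _ (a (~~ b) x) lti le_e.
have := mulr_ge0 lam_ge0 (normr_ge0 (v - a b x)).
by rewrite -!natr1; lra.
Qed.

(** Later arrows depend on the earlier ones only through the value [w] reached. *)
Lemma gain_take_drop n b v s : exists w,
  gain lam a b v s =
    gain lam a b v (take n s) + gain lam a (b (+) odd n) w (drop n s).
Proof.
elim: n b v s => [|n IH] b v [|x s] /=; try by exists v; rewrite ?addbF add0r.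
have [w ->] := IH (~~ b) (a (~~ b) x) s.
by exists w; rewrite addbN -addNb !addrA.
Qed.

(** Only the first jump depends on the starting value. *)
Lemma gain_lip b v w s :
  gain lam a b v s <= gain lam a b w s + lam * `|v - w|.
Proof.
case: s => [|x s] /=; first by rewrite add0r mulr_ge0.
have : lam * `|w - a b x| <= lam * (`|v - a b x| + `|v - w|).
  apply: ler_wpM2l => //.
  have -> : w - a b x = (v - a b x) - (v - w) by lra.
  exact: ler_normB.
by rewrite mulrDr; lra.
Qed.

End Gain.

Lemma alternating_seq_cons (T : Type) (K : bool -> set T) b x s :
  K b x -> alternating_seq K (~~ b) s -> alternating_seq K b (x :: s).
Proof.
move=> Kx Ks x0 [|i] /=; first by rewrite addbF.
by rewrite ltnS addbN -addNb; exact: Ks.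
Qed.

Lemma alternating_seq_drop (T : Type) (K : bool -> set T) b n s :
  alternating_seq K b s -> alternating_seq K (b (+) odd n) (drop n s).
Proof.
move=> Ks x0 i; rewrite size_drop ltn_subRL => lti.
by rewrite nth_drop -addbA -oddD; exact: Ks.
Qed.

(* Each block of n + 2 consecutive points contains a jump of more than
   1/(n+1), whose penalty outweighs the at most n + 2 gained by the block. *)
Lemma gain_bounded (R : realType) (T : Type) (K : bool -> set T)
    (a : bool -> T -> R) (n : nat) :
  (forall b (p : nat -> T), (forall i, K (b (+) odd i) (p i)) ->
    exists2 i : nat, (i < n)%N & n.+1%:R^-1 <
      `|a (~~ (b (+) odd i)) (p i) - a (~~ (b (+) odd i)) (p i.+1)|) ->
  forall b v s, alternating_seq K b s ->
    gain (n.+2%:R * n.+1%:R) a b v s <= n.+2%:R.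
Proof.
move=> jump b v s; have [k] := ubnP (size s).
have lam_ge0 : 0 <= n.+2%:R * n.+1%:R :> R by rewrite mulr_ge0.
elim: k b v s => // k IH b v s; rewrite ltnS => sk Ks.
have [small|large] := leqP (size s) n.+2.
  by apply: le_trans (gain_le_size a lam_ge0 _ _ _) _; rewrite ler_nat.
have [w ->] := gain_take_drop (n.+2%:R * n.+1%:R) a n.+2 b v s.
have [x0 _] : exists x0 : T, True by case: (s) large => // x; exists x.
have size_take' : size (take n.+2 s) = n.+2 by rewrite size_takel// ltnW.
(* Beyond the block, the points 0 and 1 are repeated by parity to keep the colours right; the jump
   found at i < n lies inside the block. *)
pose p i := nth x0 s (if (i < n.+2)%N then i else odd i).
have Kp i : K (b (+) odd i) (p i).
  rewrite /p; case: ifP => [lti|_]; first by apply: Ks; exact: ltn_trans large.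
  rewrite -{1}[odd i]oddb; apply: Ks; apply: leq_ltn_trans (leq_b1 _) _.
  exact: leq_ltn_trans large.
have [i ltin jumpi] := jump b p Kp.
have lti : (i < n.+2)%N by rewrite (leq_trans ltin)// -addn2 leq_addr.
have := gain_jump (a := a) lam_ge0 (x0 := x0) (e := n.+1%:R^-1) (b := b) v
  (s := take n.+2 s) (i := i).
have lti1 : (i.+1 < n.+2)%N by rewrite ltnS ltnW.
rewrite size_take' !nth_take// -mulrA divff// mulr1 subrr => /(_ lti1) block.
rewrite -[leRHS]add0r; apply: lerD.
  apply: block; apply: ltW; move: jumpi; rewrite /p lti.
  by rewrite lti1.
apply: IH; last exact: alternating_seq_drop.
by rewrite size_drop (leq_trans _ sk)// ltn_subrL (leq_ltn_trans _ large).
Qed.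

(** * A potential that drops along arrows *)

(* The potential h b v is the supremum of the gains from v of all finite
   alternating sequences. *)
Lemma alternating_separation (R : realType) (T : topologicalType)
    (K : bool -> set T) (a : bool -> T -> R) :
  (forall c, compact (K c)) -> (forall c, continuous (a c)) ->
  (forall b p, ~ alternating K a b p) ->
  exists h : bool -> R -> R, (forall b, continuous (h b)) /\
    forall b x, K b x -> h (~~ b) (a (~~ b) x) + 1 <= h b (a b x).
Proof.
move=> cK ca noalt.
have [n jump] : exists n : nat, forall b (p : nat -> T),
    (forall i, K (b (+) odd i) (p i)) ->
    exists2 i : nat, (i < n)%N & n.+1%:R^-1 <
      `|a (~~ (b (+) odd i)) (p i) - a (~~ (b (+) odd i)) (p i.+1)|.
  have [N jN] := choice (fun b => pseudopath_jump cK ca (noalt b)).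
  exists (maxn (N true) (N false)) => b p /jN[i lti jumpi].
  have leN : (N b <= maxn (N true) (N false))%N.
    by case: (b); rewrite leq_max leqnn ?orbT.
  exists i; first exact: leq_trans leN.
  by apply: le_lt_trans jumpi; rewrite lef_pV2 ?posrE// ler_nat.
pose lam : R := n.+2%:R * n.+1%:R.
have lam_gt0 : 0 < lam by rewrite mulr_gt0.
pose gains b v := [set gain lam a b v s | s in alternating_seq K b].
have gains_ub b v : has_ubound (gains b v).
  by exists n.+2%:R => _ [s Ks <-]; exact: gain_bounded jump _ _ _ Ks.
have gains0 b v : gains b v !=set0 by exists 0, [::].
pose h b v := sup (gains b v).
have h_lip b v w : h b v <= h b w + lam * `|v - w|.
  apply: ge_sup => // _ [s Ks <-].
  apply: le_trans (gain_lip a (ltW lam_gt0) b v w s) _.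
  by rewrite lerD2r; apply: ub_le_sup => //; exists s.
exists h; split=> [b v|b x Kx]; last first.
  (* Prepending x to a sequence started from [a (~~ b) x] earns 1 and costs no jump from [a b x]. *)
  rewrite -lerBrDr; apply: ge_sup => // _ [s Ks <-].
  rewrite lerBrDr; apply: ub_le_sup => //; exists (x :: s).
    exact: alternating_seq_cons.
  by rewrite /= subrr normr0 mulr0 subr0 addrC.
apply/cvgrPdist_lt => e e_gt0; near=> w.
have small : lam * `|v - w| < e.
  rewrite mulrC -ltr_pdivlMr//; near: w.
  by apply: cvgr_dist_lt => //; rewrite divr_gt0.
have := h_lip b v w; have := h_lip b w v; rewrite (distrC w) => vw wv.
by rewrite ltr_norml; apply/andP; split; lra.
Unshelve. all: by end_near. Qed.

(** * Inner products, telescoping sums and the uniform norm *)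

Lemma dot_continuous (R : realType) (d : nat) (a : 'rV[R]_d) :
  continuous (dot a).
Proof.
apply: continuous_big => [|j _]; first exact: add_continuous.
by move=> x; exact: cvgM (cvg_cst _) (@coord_continuous _ _ _ _ _ x).
Qed.

Lemma alternating_sum (R : pzRingType) (c : nat -> R) (n : nat) :
  \sum_(i < n) (-1) ^+ i * (c i + c i.+1) = c 0%N - (-1) ^+ n * c n.
Proof.
elim: n => [|n IH]; first by rewrite big_ord0 expr0 mul1r subrr.
by rewrite big_ord_recr/= IH exprS mulN1r mulNr opprK mulrDr addrA subrK.
Qed.

Section UniformNorm.
Context {R : realType} {d : nat}.
Variable Q : set 'rV[R]_d.
Hypotheses (Q0 : Q !=set0) (cQ : compact Q).
Implicit Types u g : 'rV[R]_d -> R.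

Lemma uniform_norm_attained u : {within Q, continuous u} ->
  exists2 x, Q x & uniform_norm Q u = `|u x|.
Proof.
move=> cu.
have cnu : {within Q, continuous (fun x => `|u x|)}.
  by move=> x; exact: cvg_norm (cu x).
have [x] := compact_EVT_max Q0 cQ cnu; rewrite inE => Qx umax.
exists x => //; apply/eqP; rewrite eq_le; apply/andP; split.
  apply: ge_sup => [|_ [y Qy <-]]; last by apply: umax; rewrite inE.
  by case: Q0 => y Qy; exists `|u y|, y.
apply: ub_le_sup; last by exists x.
by exists `|u x| => _ [y Qy <-]; apply: umax; rewrite inE.
Qed.

Lemma norm_le_uniform_norm u x : {within Q, continuous u} -> Q x ->
  `|u x| <= uniform_norm Q u.
Proof.
move=> cu Qx.
have cnu : {within Q, continuous (fun x => `|u x|)}.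
  by move=> y; exact: cvg_norm (cu y).
have [y Qy umax] := compact_EVT_max Q0 cQ cnu.
apply: ub_le_sup; last by exists x.
by exists `|u y| => _ [z Qz <-]; apply: umax; rewrite inE.
Qed.

Lemma uniform_norm_ge0 u : {within Q, continuous u} -> 0 <= uniform_norm Q u.
Proof. by move=> /uniform_norm_attained[x _ ->]. Qed.

(* With E = norm u, compactness gives m > 0 such that E^2 - u^2 >= m or
   u g >= m at each point of Q; expand (u - e g)^2. *)
Lemma uniform_norm_improve u g :
  {within Q, continuous u} -> {within Q, continuous g} ->
  (forall x, Q x -> `|u x| = uniform_norm Q u -> 0 < u x * g x) ->
  exists e : R, uniform_norm Q (fun x => u x - e * g x) < uniform_norm Q u.
Proof.
move=> cu cg ug_gt0; set E := uniform_norm Q u in ug_gt0 *.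
have E_ge0 : 0 <= E := uniform_norm_ge0 cu.
(* The last bracket is twice the positive part of u g. It is positive where |u| = E, and E^2 - u^2
   is positive elsewhere. *)
pose F x := E ^+ 2 - u x * u x + (`|u x * g x| + u x * g x).
have cF : {within Q, continuous F}.
  have cug : {within Q, continuous (fun x => u x * g x)}.
    by move=> x; exact: cvgM (cu x) (cg x).
  have c1 : {within Q, continuous (fun x => E ^+ 2 - u x * u x)}.
    by move=> x; exact: cvgB (cvg_cst _) (cvgM (cu x) (cu x)).
  have c2 : {within Q, continuous (fun x => `|u x * g x| + u x * g x)}.
    by move=> x; exact: cvgD (cvg_norm (cug x)) (cug x).
  by move=> x; exact: cvgD (c1 x) (c2 x).
have [y] := compact_EVT_min Q0 cQ cF; rewrite inE => Qy Fmin.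
(* If E^2 - u^2 and u g were both below m, F would be below 3 m. *)
pose m := F y / 4.
have m_gt0 : 0 < m.
  have := ler_norm (- (u y * g y)); rewrite normrN => ?.
  rewrite divr_gt0// /F; have := norm_le_uniform_norm cu Qy.
  rewrite le_eqVlt => /predU1P[uE|lt_uE].
    rewrite -expr2 -(@real_normK _ (u y)) ?num_real// uE subrr add0r.
    by rewrite ltr_wpDl// ug_gt0.
  have : u y ^+ 2 < E ^+ 2.
    by rewrite -(@real_normK _ (u y)) ?num_real// ltr_pXn2r ?nnegrE.
  by lra.
have FyE : F y = 4 * m by rewrite /m mulrC divfK// pnatr_eq0.
clearbody m; set B := uniform_norm Q g.
have B_ge0 : 0 <= B := uniform_norm_ge0 cg.
pose D := 2 * E * B + B ^+ 2 + 1.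
have D_gt0 : 0 < D by rewrite /D; nra.
(* This gives e < 1 and e D < m, so m exceeds 2 e E B + e^2 B^2 in the first case below, and e m
   exceeds e^2 B^2 in the second. *)
pose e := m / (m + D).
have mD_gt0 : 0 < m + D by rewrite addr_gt0.
have e_gt0 : 0 < e by rewrite divr_gt0.
have e_lt1 : e < 1 by rewrite /e ltr_pdivrMr// mul1r ltrDl.
have eD : e * D < m by rewrite /e mulrAC ltr_pdivrMr// ltr_pM2l// ltrDr.
exists e.
have cue : {within Q, continuous (fun x => u x - e * g x)}.
  by move=> x; exact: cvgB (cu x) (cvgM (cvg_cst _) (cg x)).
have [x Qx ->] := uniform_norm_attained cue.
have leu := norm_le_uniform_norm cu Qx.
have leg := norm_le_uniform_norm cg Qx.
rewrite -/E in leu; rewrite -/B in leg.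
rewrite -(@ltr_pXn2r _ 2) ?nnegrE// real_normK ?num_real//.
have u2 : u x ^+ 2 <= E ^+ 2.
  by rewrite -[leLHS]real_normK ?num_real// ler_pXn2r ?nnegrE.
have g2 : g x ^+ 2 <= B ^+ 2.
  by rewrite -[leLHS]real_normK ?num_real// ler_pXn2r ?nnegrE.
have ug : - (E * B) <= u x * g x.
  by have /ler_normlP[+ _] : `|u x * g x| <= E * B; [|lra];
     rewrite normrM ler_pM.
have Fx : F y <= F x by apply: Fmin; rewrite inE.
have [mu|mug] : m <= E ^+ 2 - u x * u x \/ m <= u x * g x.
  have [?|ltm] := leP m (E ^+ 2 - u x * u x); [by left|right].
  rewrite leNgt; apply/negP => ugm; move: Fx; rewrite FyE /F leNgt => /negP; apply.
  by have [_|_] := ger0P (u x * g x); lra.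
  suff : u x ^+ 2 - 2 * e * (u x * g x) + e ^+ 2 * g x ^+ 2 < E ^+ 2 by lra.
  have h1 : e ^+ 2 * g x ^+ 2 <= e * B ^+ 2.
    by rewrite ler_pM ?sqr_ge0// expr2 ger_pMr// ltW.
  have h2 : - (e * (E * B)) <= e * (u x * g x) by rewrite -mulrN ler_pM2l.
  by rewrite /D in eD; lra.
have h1 : e ^+ 2 * g x ^+ 2 <= e * (e * B ^+ 2).
  by rewrite mulrA -expr2 ler_pM2l// exprn_gt0.
have h2 : e * m <= e * (u x * g x) by rewrite ler_pM2l.
have h3 : e * (e * B ^+ 2) < e * m.
  rewrite ltr_pM2l//; apply: le_lt_trans eD; rewrite ler_pM2l// /D.
  by have := mulr_ge0 E_ge0 B_ge0; lra.
suff : u x ^+ 2 - 2 * e * (u x * g x) + e ^+ 2 * g x ^+ 2 < E ^+ 2 by lra.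
have : 0 < e * m by rewrite mulr_gt0.
lra.
Qed.

End UniformNorm.

(** * Ridge sums along paths *)

Section Ridge.
Context {R : realType} {d : nat}.
Variables (Q : set 'rV[R]_d) (a1 a2 : 'rV[R]_d).
Implicit Types f g u : 'rV[R]_d -> R.

Lemma within_continuous_dot (a : 'rV[R]_d) (h : R -> R) : continuous h ->
  {within Q, continuous (fun x => h (dot a x))}.
Proof.
move=> ch; apply: continuous_subspaceT => x.
exact: (continuous_comp (@dot_continuous _ _ a x) (ch _)).
Qed.

Lemma ridge_sums_continuous g :
  ridge_sums Q a1 a2 g -> {within Q, continuous g}.
Proof.
move=> [g1 [g2 [cg1 cg2 gE]]].
have gE' : {in Q, (fun x => g1 (dot a1 x) + g2 (dot a2 x)) =1 g}.
  by move=> x; rewrite inE => Qx; rewrite gE.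
have cg : {within Q, continuous (fun x => g1 (dot a1 x) + g2 (dot a2 x))}.
  exact: within_continuousD (within_continuous_dot cg1) (within_continuous_dot cg2).
exact: subspace_eq_continuous gE' cg.
Qed.

(** Serves to perturb [g0] and, with e = -1, to compare it with another ridge sum. *)
Lemma ridge_sums_axpy (e : R) g0 g :
  ridge_sums Q a1 a2 g0 -> ridge_sums Q a1 a2 g ->
  ridge_sums Q a1 a2 (fun x => g0 x + e * g x).
Proof.
move=> [h1 [h2 [ch1 ch2 g0E]]] [k1 [k2 [ck1 ck2 gE]]].
exists (fun t => h1 t + e * k1 t), (fun t => h2 t + e * k2 t).
split=> [x|x|x Qx].
- exact: cvgD (ch1 x) (cvgM (cvg_cst _) (ck1 x)).
- exact: cvgD (ch2 x) (cvgM (cvg_cst _) (ck2 x)).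
- by rewrite g0E// gE// mulrDr addrACA.
Qed.

(** The even length preserves the alternation of directions and signs when the path wraps around. *)
Lemma closed_path_infinite u s : closed_path Q a1 a2 s ->
  extremal_finite Q u s ->
  exists p, infinite_path Q a1 a2 p /\ extremal_infinite Q u p.
Proof.
move=> [[s0 sQ _] even_s [_ _ [b links]]] ext.
have n_gt0 : (0 < size s)%N by case: (s) s0.
pose p i := nth 0 s (i %% size s).
have lt_mod i : (i %% size s < size s)%N by rewrite ltn_mod.
have odd_mod i : odd (i %% size s) = odd i.
  by rewrite [in RHS](divn_eq i (size s)) oddD oddM (negbTE even_s) andbF.
exists p; split; last first.
  by case: ext => ext; [left|right] => i; rewrite /p ext//
    -[in LHS]signr_odd -[in RHS]signr_odd /= odd_mod.
split=> [i|]; first by apply: sQ; rewrite mem_nth.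
exists b => i; have := links (i %% size s)%N.
rewrite size_rcons ltnS lt_mod => /(_ isT); rewrite /link odd_mod.
rewrite !nth_rcons lt_mod /p -[i.+1]addn1 -(modnDml i 1) addn1.
have [lt1|] := ltnP; first by rewrite (modn_small lt1).
move: (lt_mod i); rewrite leq_eqVlt.
case: eqP => [->|_ /= h1 h2]; last by rewrite ltnNge h2 in h1.
by rewrite modnn nth0.
Qed.

(* Along a path, the values of a ridge sum have the form c_i + c_{i+1}, where
   c_i is the summand attached to the link entering the i-th point; their
   alternating sums telescope and stay bounded, so they cannot compensate the
   values of an extremal function. *)
Lemma infinite_path_le_uniform_norm (p : nat -> 'rV[R]_d) u g :
  Q !=set0 -> compact Q -> {within Q, continuous u} ->
  ridge_sums Q a1 a2 g -> infinite_path Q a1 a2 p ->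
  extremal_infinite Q u p ->
  uniform_norm Q u <= uniform_norm Q (fun x => u x + g x).
Proof.
move=> Q0 cQ cu rg [pQ [b links]] ext.
have cg := ridge_sums_continuous rg.
have cug : {within Q, continuous (fun x => u x + g x)}.
  by move=> x; exact: cvgD (cu x) (cg x).
(* [t] is the value at the first point, which unites the two sign patterns. *)
have [t tE uE] : exists2 t, `|t| = uniform_norm Q u &
    forall i, u (p i) = (-1) ^+ i * t.
  case: ext => ext; [exists (- uniform_norm Q u)|exists (uniform_norm Q u)].
  - by rewrite normrN ger0_norm// uniform_norm_ge0.
  - by move=> i; rewrite ext exprS mulN1r mulNr mulrN.
  - by rewrite ger0_norm// uniform_norm_ge0.
  - by [].
have [g1 [g2 [cg1 cg2 gE]]] := rg.
pose G c x := if c then g2 (dot a2 x) else g1 (dot a1 x).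
pose c i := G (~~ (b (+) odd i)) (p i).
have gc i : g (p i) = c i + c i.+1.
  (* The link leaving the i-th point preserves exactly this summand. *)
  have -> : c i.+1 = G (b (+) odd i) (p i).
    have [_ /=] := links i; rewrite /c /= -addbN negbK /G.
    by case: ifP => _ ->.
  by rewrite gE// /c /G; case: (b (+) odd i); rewrite //= addrC.
pose C := uniform_norm Q (G true) + uniform_norm Q (G false).
have c1 := within_continuous_dot (a := a1) cg1.
have c2 := within_continuous_dot (a := a2) cg2.
have cC i : `|c i| <= C.
  rewrite /C /c; case: (~~ _).
    by rewrite ler_wpDr ?uniform_norm_ge0// norm_le_uniform_norm.
  by rewrite ler_wpDl ?uniform_norm_ge0// norm_le_uniform_norm.
set N := uniform_norm Q (fun x => u x + g x).
have bound n : n%:R * (uniform_norm Q u - N) <= 2 * C.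
  have sumE : \sum_(i < n) (-1) ^+ i * (u (p i) + g (p i)) =
      n%:R * t + (c 0%N - (-1) ^+ n * c n).
    under eq_bigr do rewrite uE gc mulrDr mulrA -exprMn mulrNN mulr1 expr1n mul1r.
    by rewrite big_split/= sumr_const card_ord mulr_natl alternating_sum.
  have sum_le : `|\sum_(i < n) (-1) ^+ i * (u (p i) + g (p i))| <= n%:R * N.
    apply: le_trans (ler_norm_sum _ _ _) _.
    rewrite mulr_natl -[in leRHS](card_ord n) -sumr_const; apply: ler_sum => i _.
    rewrite normrM normrX normrN1 expr1n mul1r.
    exact: (norm_le_uniform_norm Q0 cQ cug (pQ i)).
  have ntE : n%:R * uniform_norm Q u = `|n%:R * t| by rewrite normrM tE normr_nat.
  have nt : `|n%:R * t| <= n%:R * N + (`|c 0%N| + `|c n|).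
    have -> : n%:R * t = \sum_(i < n) (-1) ^+ i * (u (p i) + g (p i)) -
      (c 0%N - (-1) ^+ n * c n) by rewrite sumE addrK.
    apply: le_trans (ler_normB _ _) _; apply: lerD => //.
    apply: le_trans (ler_normB _ _) _.
    by rewrite normrM normrX normrN1 expr1n mul1r.
  by have := cC 0%N; have := cC n; lra.
rewrite leNgt -subr_gt0; apply/negP => gap.
have := bound (Num.truncn (2 * C / (uniform_norm Q u - N))).+1.
by rewrite leNgt -ltr_pdivrMr// truncnS_gt.
Qed.

(** * Necessity: improving [g0] when no infinite extremal path exists *)

Lemma best_approximation_infinite_path f g0 :
  Q !=set0 -> compact Q -> {within Q, continuous f} ->
  0 < uniform_norm Q (f \- g0) -> best_approximation Q a1 a2 f g0 ->
  exists p, infinite_path Q a1 a2 p /\ extremal_infinite Q (f \- g0) p.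
Proof.
move=> Q0 cQ cf; set u := f \- g0; set E := uniform_norm Q u => E_gt0.
move=> [rg0 best]; apply: contrapT => nopath.
have cu : {within Q, continuous u}.
  exact: within_continuousB cf (ridge_sums_continuous rg0).
pose K b := [set x | Q x /\ u x = (if b then E else - E)].
pose a b := dot (if b then a1 else a2).
have cK b : compact (K b).
  have [V clV VQ] : exists2 V : set 'rV[R]_d, closed V &
      V `&` Q = u @^-1` [set if b then E else - E] `&` Q.
    apply/closed_subspaceP; move/continuous_closedP : cu; apply.
    exact: closed_eq.
  have -> : K b = Q `&` V.
    by rewrite setIC VQ setIC.
  exact: compact_closedI.
have ca b : continuous (a b) by exact: dot_continuous.
have noalt b p : ~ alternating K a b p.
  move=> alt; apply: nopath; exists p; split; last first.
    have uE i : u (p i) = (-1) ^+ i * (if b then E else - E).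
      have [[_ ->] _] := alt i; rewrite -signr_odd.
      by case: (b); case: (odd i); rewrite /= ?mulN1r ?mul1r ?opprK.
    by case: (b) uE => uE; [right|left] => i;
       rewrite uE// exprS mulN1r mulNr mulrN.
  split=> [i|]; first by have [[]] := alt i.
  exists b => i; have [[_ ui] di] := alt i; have [[_ ui1] _] := alt i.+1.
  split; last by move: di; rewrite /a; case: (b (+) odd i).
  (* Consecutive points differ because u takes the values E and -E there, and E > 0. *)
  move=> pE; move: ui1; rewrite -pE ui /= addbN.
  by case: (b (+) odd i) => /= ?; lra.
have [h [ch hK]] := alternating_separation cK ca noalt.
(* The minus sign turns the drop of the potential into g >= 1 on [K true] and g <= -1 on
   [K false]. *)
pose g x := h true (dot a1 x) - h false (dot a2 x).
have rg : ridge_sums Q a1 a2 g.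
  exists (h true), (fun t => - h false t); split=> // x.
  exact: cvgN (ch false x).
have [e lt_e] : exists e : R, uniform_norm Q (fun x => u x - e * g x) < E.
  apply: uniform_norm_improve => //; first exact: ridge_sums_continuous.
  move=> x Qx; have [ux0|ux0] := ger0P (u x) => uE.
    have /hK /= hx : K true x by [].
    by rewrite uE mulr_gt0// /g; move: hx; rewrite /a /=; lra.
  have uE' : u x = - E by rewrite /E -uE opprK.
  have /hK /= hx : K false x by [].
  rewrite uE' mulNr oppr_gt0 pmulr_rlt0// /g.
  by move: hx; rewrite /a /=; lra.
suff : E <= uniform_norm Q (fun x => u x - e * g x) by rewrite leNgt lt_e.
rewrite [leLHS]best; apply: ge_inf.
  exists 0 => _ [k rk <-]; apply: uniform_norm_ge0 => //.
  exact: within_continuousB cf (ridge_sums_continuous rk).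
exists (fun x => g0 x + e * g x); first exact: ridge_sums_axpy.
by congr uniform_norm; apply/funext => x /=; rewrite opprD addrA.
Qed.

End Ridge.

Theorem theorem1p3 (R : realType) (d : nat) (a1 a2 : 'rV[R]_d)
    (Q : set 'rV[R]_d) (f g0 : 'rV[R]_d -> R)
    (ha1 : a1 <> 0) (ha2 : a2 <> 0)
    (hQ0 : Q !=set0) (hQconvex : convex_set Q) (hQcompact : compact Q)
    (hA : uniformly_closable Q a1 a2)
    (hf : {within Q, continuous f})
    (hg0 : ridge_sums Q a1 a2 g0) :
  best_approximation Q a1 a2 f g0 <->
  (exists l : seq 'rV[R]_d,
      closed_path Q a1 a2 l /\ extremal_finite Q (f \- g0) l) \/
  (exists l : nat -> 'rV[R]_d,
      infinite_path Q a1 a2 l /\ extremal_infinite Q (f \- g0) l).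
Proof.
have cu : {within Q, continuous (f \- g0)}.
  exact: within_continuousB hf (ridge_sums_continuous hg0).
split=> [best|path].
  have := uniform_norm_ge0 hQ0 hQcompact cu; rewrite le_eqVlt => /predU1P[u0|].
    have [x Qx] := hQ0; have [N [_ closable]] := hA.
    (* Condition (A) closes up a one-point path; f - g0 vanishes on Q, so either sign pattern
       holds. *)
    have [|r [_ cl]] := closable [:: x].
      split=> //; last by exists true.
      by move=> y; rewrite inE => /eqP ->.
    left; exists ([:: x] ++ r); split=> //; right => i lti.
    have [[_ inQ _] _ _] := cl.
    have := norm_le_uniform_norm hQ0 hQcompact cu (inQ _ (mem_nth 0 lti)).
    by rewrite -u0 mulr0 normr_le0 => /eqP.
  by move=> u_gt0; right; exact: best_approximation_infinite_path.
have [p [pathp extp]] : exists p, infinite_path Q a1 a2 p /\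
    extremal_infinite Q (f \- g0) p.
  by case: path => [[l [cl ext]]|//]; exact: closed_path_infinite ext.
split=> //; apply/eqP; rewrite eq_le; apply/andP; split.
  apply: lb_le_inf; first by exists (uniform_norm Q (f \- g0)), g0.
  move=> _ [g rg <-].
  (* Adding the ridge sum g0 - g to f - g0 gives f - g. *)
  have rh := ridge_sums_axpy (-1) hg0 rg.
  have := infinite_path_le_uniform_norm hQ0 hQcompact cu rh pathp extp.
  congr (_ <= uniform_norm Q _); apply/funext => x /=.
  by rewrite mulN1r addrA subrK.
apply: ge_inf; last by exists g0.
exists 0 => _ [g rg <-]; apply: uniform_norm_ge0 => //.
  exact: within_continuousB hf (ridge_sums_continuous rg).
Qed.
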